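(* Let $p$ be a prime, let $s,r\ge1$ be integers, $q=p^r$, and let $m$ be a positive integer such that $rm\ge s$; put $n=q^m-1$, $L=GR(p^s,r)$, $\mathcal{R}=GR(p^s,rm)$, and let $T:\mathcal{R}\to L$ be the relative trace. Let $1\le\nu\le m(q-1)$. Then $RM_L(\nu,m)$ is generated (as an $L$-module) by the repetition code $RM_L(0,m)$ together with all $q^m$-tuples of the form $$(0,T(\lambda_j),T(\lambda_j\xi^j),T(\lambda_j\xi^{2j}),\dots,T(\lambda_j\xi^{(n-1)j})),$$ where $j$ ranges over a system of representatives of those cyclotomic cosets modulo $q^m-1$ for which $w_q(j)\le\nu$, and $\lambda_j$ ranges over $\mathcal{R}$.
   Context: $L=GR(p^s,r)$ is the Galois ring of characteristic $p^s$ with $p^{sr}$ elements; it is local with maximal ideal $pL$ and residue field $\mathbb{F}_q$. Let $h(x)\in L[x]$ be a monic basic primitive polynomial of degree $m$ (i.e. its reduction mod $p$ is a primitive polynomial over $\mathbb{F}_q$) dividing $x^{n}-1$, with a root $\xi$ of multiplicative order $n$ in $\mathcal{R}=L[x]/(h(x))=GR(p^s,rm)$. Then $\{1,\xi,\dots,\xi^{m-1}\}$ is an $L$-basis of $\mathcal{R}$. For $0\le i\le n-1$ write uniquely $\xi^i=b_{1i}+b_{2i}\xi+\dots+b_{mi}\xi^{m-1}$ with $b_{ji}\in L$, and set $b_i=(b_{1i},\dots,b_{mi})\in L^m$, $b_\infty=(0,\dots,0)$. For $P\in L[x_1,\dots,x_m]$ let $ev(P)=(P(b_\infty),P(b_0),P(b_1),\dots,P(b_{n-1}))\in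 L^{q^m}$. The generalized Reed-Muller code of order $\nu$ ($0\le\nu\le m(q-1)$) over $L$ is $$RM_L(\nu,m)=\{ev(P)\mid P\in L[x_1,\dots,x_m],\ \deg_{x_i}P\le q-1\ (1\le i\le m),\ \deg P\le\nu\},$$ where $\deg$ is the total degree and $\deg 0=-\infty$. In particular $RM_L(0,m)$ is the repetition code of length $q^m$. Every $c\in\mathcal{R}$ has a unique representation $c=\xi_0+p\xi_1+\dots+p^{s-1}\xi_{s-1}$ with $\xi_i\in\{0,1,\xi,\dots,\xi^{n-1}\}$. The Frobenius automorphism is $c\mapsto c^f=\xi_0^q+p\xi_1^q+\dots+p^{s-1}\xi_{s-1}^q$; it has order $m$ and fixed ring $L$. The relative trace is $T(c)=c+c^f+\dots+c^{f^{m-1}}$. For $0\le k\le q^m-1$ with base-$q$ expansion $k=\sum_{i=0}^{m-1}a_iq^i$, $0\le a_i\le q-1$, the $q$-weight is $w_q(k)=\sum_{i=0}^{m-1}a_i$. The cyclotomic coset of $j$ modulo $q^m-1$ is $\{j,jq,jq^2,\dots,jq^{m-1}\}$ modulo $q^m-1$.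
   Formalization: Representatives j are taken in {1,…,q^m−1}, so the zero coset is represented by q^m−1 (weight m(q−1)), not by j=0; with j=0 allowed the claim fails, e.g. p=q=2, s=1, m=2, ν=1, where (0,1,1,1) is not in RM(1,2). *)

(* Defs.v *)
From mathcomp Require Import all_boot all_order all_algebra all_field.
From mathcomp Require Import mpoly.

Set Implicit Arguments.
Unset Strict Implicit.
Unset Printing Implicit Defensive.

Import GRing.Theory.
Local Open Scope ring_scope.

(* GR(p^s, r) is determined up to isomorphism by these properties. *)
Definition galois_ring (p s r : nat) (L : finComUnitRingType) : Prop :=
  [/\ forall k : nat, (k%:R = 0 :> L) <-> (p ^ s %| k)%N,
      #|L| = (p ^ (s * r))%N
    & forall x : L, (x \isn't a GRing.unit) <-> exists y, x = p%:R * y].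

(* red exhibits F as the residue field L / pL, which is F_q. *)
Definition reduction_mod (p : nat) (L : finComUnitRingType) (F : finFieldType)
    (red : {rmorphism L -> F}) : Prop :=
  (forall z : F, exists x, red x = z) /\
  (forall x : L, red x = 0 <-> exists y, x = p%:R * y).

Definition basic_primitive (L : finComUnitRingType) (F : finFieldType)
    (red : {rmorphism L -> F}) (h : {poly L}) : Prop :=
  h \is monic /\ primitive_poly (map_poly red h).

Section Trace.
Variables (p s q m n : nat) (L : finComUnitRingType) (R : comAlgType L) (xi : R).

(* An element of {0, 1, xi, ..., xi^(n-1)}; None encodes 0. *)
Definition teichmuller (o : option 'I_n) : R :=
  if o is Some i then xi ^+ i else 0.

(* The digits of c are unique when R is the Galois ring GR(p^s, r m) and xi has
   order n = p^(r m) - 1; the default value 0 is then never used. *)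
Definition frobenius (c : R) : R :=
  if [pick u : {ffun 'I_s -> option 'I_n} |
        c == \sum_(i < s) p%:R ^+ i * teichmuller (u i)] is Some u
  then \sum_(i < s) p%:R ^+ i * teichmuller (u i) ^+ q
  else 0.

(* The sum of conjugates lies in L, embedded in R as a |-> a%:A. *)
Definition rel_trace (c : R) : L :=
  odflt 0 [pick a : L | a%:A == \sum_(i < m) iter i frobenius c].

(* Coordinate 0 is the one written infinity; coordinate i + 1 is the one of
   xi^i. *)
Definition trace_word (j : nat) (lambda : R) : 'rV[L]_n.+1 :=
  \row_(i < n.+1)
    if unlift ord0 i is Some k then rel_trace (lambda * xi ^+ (k * j)) else 0.

End Trace.

Section ReedMuller.
Variables (q m n : nat) (L : finComUnitRingType) (b : 'I_n -> 'rV[L]_m).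

Definition ev (P : {mpoly L[m]}) : 'rV[L]_n.+1 :=
  \row_(i < n.+1)
    P.@[fun l => if unlift ord0 i is Some k then b k 0 l else 0].

(* msize P is deg P + 1, and msize 0 = 0. *)
Definition RM (nu : nat) (c : 'rV[L]_n.+1) : Prop :=
  exists P : {mpoly L[m]},
    [/\ forall mon, mon \in msupp P -> forall i, (mon i <= q.-1)%N,
        (msize P <= nu.+1)%N
      & c = ev P].

End ReedMuller.

Definition qweight (q m k : nat) : nat := (\sum_(i < m) (k %/ q ^ i) %% q)%N.

(* The elements of a coset are taken in {1, ..., q^m - 1}: the zero class modulo
   n = q^m - 1 is represented by n, whose q-weight is m(q-1), and not by 0. *)
Definition cyclotomic_coset (q m n j : nat) : {set 'I_n.+1} :=
  [set i : 'I_n.+1 | (0 < i)%N && [exists k : 'I_m, i == j * q ^ k %[mod n]]].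

Definition coset_representatives (q m n nu : nat) (J : {set 'I_n.+1}) : Prop :=
  (forall j, j \in J -> (0 < j)%N /\ (qweight q m j <= nu)%N) /\
  (forall j : 'I_n.+1, (0 < j)%N -> (qweight q m j <= nu)%N ->
     #|J :&: cyclotomic_coset q m n j| = 1%N).

Definition generated_by (L : nzRingType) (V : lmodType L) (S : V -> Prop) (c : V)
    : Prop :=
  exists (k : nat) (a : 'I_k -> L) (v : 'I_k -> V),
    (forall i, S (v i)) /\ c = \sum_(i < k) a i *: v i.

(* Main.v *)
From HB Require Import structures.
Require Import Defs.
From mathcomp Require Import all_boot all_order all_algebra all_field.
From mathcomp Require Import mpoly ring.

Set Implicit Arguments.
Unset Strict Implicit.
Unset Printing Implicit Defensive.

Import GRing.Theory.
Local Open Scope ring_scope.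

(* A word over L is a function on the point set {0, 1, xi, ...,
   xi^(n-1)}, and the Frobenius phi, which fixes L, turns the coordinates of a
   point t into linear combinations over R of the t^(q^k).  A monomial of degree
   d in the coordinates is therefore an R-combination of powers t^j with q-weight
   at most d.  Reduced monomials stay independent modulo p, and as many of them
   have degree at most d as there are j with q-weight at most d, so both families
   span the same R-module W_d.  If tr is the relative trace and tr c0 = 1, then
   w = tr (c0 w) for L-valued w: applied to an expansion of w in powers t^j this
   gives trace words, applied to one in reduced monomials it gives a word of the
   Reed-Muller code. *)

(** * Base-q expansions *)

Lemma sum_digits_mod q m j : (0 < q)%N ->
  (\sum_(i < m) (j %/ q ^ i %% q) * q ^ i)%N = (j %% q ^ m)%N.
Proof.
move=> q_gt0; elim: m j => [|m IHm] j; first by rewrite big_ord0 modn1.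
rewrite big_ord_recl expn0 divn1 muln1.
rewrite (eq_bigr (fun i : 'I_m => (q * ((j %/ q) %/ q ^ i %% q * q ^ i))%N)).
  rewrite -big_distrr /= IHm {3}(divn_eq j q) expnS.
  rewrite {2}(divn_eq (j %/ q) (q ^ m)) mulnDl -mulnA (mulnC (q ^ m)%N) -addnA.
  rewrite modnMDl [RHS]modn_small; first by rewrite addnC mulnC.
  have lt1 : (j %/ q %% q ^ m < q ^ m)%N by rewrite ltn_mod expn_gt0 q_gt0.
  have lt2 : (j %% q < q)%N by rewrite ltn_mod.
  rewrite (leq_trans (_ : _ < (j %/ q %% q ^ m).+1 * q)%N) //.
    by rewrite mulSn addnC ltn_add2r.
  by rewrite mulnC leq_mul2l lt1 orbT.
by move=> i _; rewrite lift0 expnS divnMA [in RHS]mulnCA.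
Qed.

Lemma sum_digits q m j : (0 < q)%N -> (j < q ^ m)%N ->
  (\sum_(i < m) (j %/ q ^ i %% q) * q ^ i)%N = j.
Proof. by move=> q_gt0 lt_j; rewrite sum_digits_mod // modn_small. Qed.

Lemma sum_expn_lt q m (e : 'I_m -> nat) : (forall i, (e i < q)%N) ->
  (\sum_(i < m) e i * q ^ i < q ^ m)%N.
Proof.
elim: m e => [|m IHm] e lt_e; first by rewrite big_ord0.
rewrite big_ord_recr /= expnS.
rewrite (leq_trans (_ : _ < q ^ m + e ord_max * q ^ m)%N) //.
  by rewrite ltn_add2r (IHm (fun i => e (widen_ord (leqnSn m) i))).
by rewrite -mulSn leq_mul2r lt_e orbT.
Qed.

Lemma digit_sum_expn q m (e : 'I_m -> nat) (k : 'I_m) :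
  (forall i, (e i < q)%N) ->
  ((\sum_(i < m) e i * q ^ i) %/ q ^ k %% q)%N = e k.
Proof.
elim: m e k => [|m IHm] e k lt_e; first by case: k.
have q_gt0 : (0 < q)%N by apply: leq_ltn_trans (lt_e k).
rewrite big_ord_recl expn0 muln1.
rewrite (eq_bigr (fun i : 'I_m => (q * (e (lift ord0 i) * q ^ i))%N));
  last first.
  by move=> i _; rewrite lift0 expnS mulnCA.
rewrite -big_distrr /=; case: (unliftP ord0 k) => [i ->|->].
  rewrite lift0 expnS divnMA [(e ord0 + _)%N]addnC [(q * \sum_(_ < _) _)%N]mulnC.
  rewrite divnMDl // (divn_small (lt_e _)) addn0.
  exact: (IHm (fun i => e (lift ord0 i))).
by rewrite expn0 divn1 addnC mulnC modnMDl modn_small.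
Qed.

(* Carrying, cyclically since q ^ m = 1 mod n, never increases the digit sum. *)
Lemma qweight_carry q m n (e : 'I_m -> nat) : (1 < q)%N -> n.+1 = (q ^ m)%N ->
  exists j : 'I_n.+1,
    [/\ (qweight q m j <= \sum_i e i)%N,
        j = \sum_i e i * q ^ i %[mod n]
      & (j == 0 :> nat) = ((\sum_i e i * q ^ i)%N == 0)]%N.
Proof.
move=> q_gt1 n_def; have q_gt0 := ltnW q_gt1.
(* Induction on the digit sum, which each carry lowers by q - 1. *)
have [d le_d] := ubnP (\sum_i e i); elim: d => // d IHd in e le_d *.
have [/forallP lt_e|] := boolP [forall i, (e i < q)%N].
  have lt_n : (\sum_i e i * q ^ i < n.+1)%N by rewrite n_def sum_expn_lt.
  exists (Ordinal lt_n); split => //=.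
  by rewrite /qweight leq_sum // => i _; rewrite digit_sum_expn.
rewrite negb_forall => /existsP[k]; rewrite -leqNgt => le_q.
(* One carry: q units at place k become one unit at the next place, [ordS] wrapping the last place
   to place 0. *)
pose e' i := (e i - (i == k) * q + (i == ordS k))%N.
have e'E i : (e' i + (i == k) * q = e i + (i == ordS k))%N.
  rewrite /e' addnAC subnK //.
  by case: eqP => [->|_]; rewrite ?mul1n.
have sum1 (f : 'I_m -> nat) k' : (\sum_i (i == k') * f i = f k')%N.
  rewrite (bigD1 k') //= eqxx mul1n big1 ?addn0 // => i /negPf->.
  by rewrite mul0n.
have sumE : (\sum_i e' i + q = \sum_i e i + 1)%N.
  rewrite -(sum1 (fun=> q) k) -[1%N](sum1 (fun=> 1%N) (ordS k)) -!big_split /=.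
  by apply: eq_bigr => i _; rewrite e'E muln1.
have valE : (\sum_i e' i * q ^ i + q ^ k.+1
             = \sum_i e i * q ^ i + q ^ ordS k)%N.
  rewrite -(sum1 (fun i => (q ^ i.+1)%N) k) -(sum1 (fun i => (q ^ i)%N) (ordS k)).
  rewrite -!big_split /=.
  by apply: eq_bigr => i _; rewrite expnS mulnA -!mulnDl e'E.
have [|j [wj jE j0]] := IHd e'.
  by rewrite -(ltn_add2r q) sumE -addnS leq_add.
exists j; split.
- by apply: leq_trans wj _; rewrite -(leq_add2r q) sumE leq_add2l.
- rewrite jE; apply/eqP; rewrite -(eqn_modDr (q ^ k.+1)) valE eqn_modDl.
  have [lt_k|ge_k] := ltnP k.+1 m; first by rewrite /= (modn_small lt_k).
  rewrite /=; have -> : k.+1 = m by apply/eqP; rewrite eqn_leq ge_k ltn_ord.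
  by rewrite modnn expn0 -n_def -[n.+1]addn1 modnDl.
(* Before and after the carry some digit is positive, so the value 0 is never created; this keeps
   exponent 0 apart from exponent n. *)
- rewrite j0; have e'_gt0 : (0 < e' (ordS k))%N by rewrite /e' eqxx addn1.
  have e_gt0 : (0 < e k)%N by apply: leq_trans le_q.
  rewrite (bigD1 (ordS k)) // [in RHS](bigD1 k) //= !addn_eq0 !muln_eq0.
  by rewrite !expn_eq0 !eqn0Ngt e'_gt0 e_gt0 q_gt0.
Qed.

(** At t = 0 the exponent 0 and the positive multiples of n give different powers, hence the
    separate condition on being zero. *)
Lemma expr_mod_eq (R : nzRingType) (t : R) n i j :
  t = 0 \/ t ^+ n = 1 -> i = j %[mod n] -> (i == 0 :> nat) = (j == 0) ->
  t ^+ i = t ^+ j.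
Proof.
case=> [->|tn1] eq_mod; first by rewrite !expr0n => ->.
by rewrite -(expr_mod i tn1) eq_mod expr_mod.
Qed.

(** Two iterates coincide by pigeonhole, and injectivity cancels the common ones. The injection
    [code] into a finite type expresses that V is finite. *)
Lemma inj_periodic (V : Type) (T : finType) (code : V -> T) (f : V -> V) y :
  injective code -> injective f -> exists k, iter k.+1 f y = y.
Proof.
move=> code_inj f_inj; pose g (i : 'I_#|T|.+1) := code (iter i f y).
have : ~~ injectiveb g.
  apply/negP => /injectiveP/leq_card; rewrite card_ord ltnn //.
case/injectivePn => i [j neq_ij /code_inj].
wlog lt_ij : i j neq_ij / (i < j)%N => [IH|].
  move: (neq_ij); rewrite -val_eqE neq_ltn => /orP[] lt_ij eq_ij.
    exact: IH eq_ij.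
  by apply: (IH j i); rewrite // eq_sym.
rewrite -{1}(subnKC lt_ij) addSnnS iterD => eq_ij; exists (j - i.+1)%N.
move: (j - i.+1)%N eq_ij => d.
by elim: (nat_of_ord i) => [|k IHk] /= => [<- //|/f_inj/IHk].
Qed.

Lemma mx_inverse_of_det (R : comNzRingType) k (A : 'M[R]_k) d :
  \det A * d = 1 -> {B | A *m B = 1%:M & B *m A = 1%:M}.
Proof.
move=> detA; exists (d *: \adj A).
  by rewrite -scalemxAr mul_mx_adj scale_scalar_mx mulrC detA.
by rewrite -scalemxAl mul_adj_mx scale_scalar_mx mulrC detA.
Qed.

Lemma sum_prod_digits (S : comNzRingType) q m n (F : 'I_m -> nat -> S) :
  (0 < q)%N -> n.+1 = (q ^ m)%N ->
  \sum_(j < n.+1) \prod_l F l (j %/ q ^ l %% q)%N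
    = \prod_l \sum_(e < q) F l e.
Proof.
move=> q_gt0 n_def; rewrite bigA_distr_bigA /=.
pose d (j : 'I_n.+1) : {ffun 'I_m -> 'I_q} :=
  [ffun l => Ordinal (ltn_pmod (j %/ q ^ val l) q_gt0)].
have lt_n (f : {ffun 'I_m -> 'I_q}) : (\sum_i f i * q ^ i < n.+1)%N.
  by rewrite n_def sum_expn_lt.
rewrite (reindex d) /=; last first.
  exists (fun f => Ordinal (lt_n f)) => [j|f] _.
    apply: val_inj => /=; under eq_bigr do rewrite ffunE.
    by rewrite sum_digits // -n_def.
  by apply/ffunP => l; apply: val_inj; rewrite ffunE /= digit_sum_expn.
by apply: eq_bigr => j _; apply: eq_bigr => l _; rewrite ffunE.
Qed.

Lemma mon_digits_inj q m n (i j : 'I_n.+1) : (0 < q)%N -> n.+1 = (q ^ m)%N ->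
  (forall l : 'I_m, i %/ q ^ l %% q = j %/ q ^ l %% q)%N -> i = j.
Proof.
move=> q_gt0 n_def eq_ij; apply: ord_inj.
rewrite -(@sum_digits q m i) -?n_def // -(@sum_digits q m j) -?n_def //.
by apply: eq_bigr => l _; rewrite eq_ij.
Qed.

Lemma prim_root_option_inj (K : fieldType) n (z : K) : n.-primitive_root z ->
  injective (fun o : option 'I_n => if o is Some i then z ^+ i else 0).
Proof.
move=> z_prim; have n_gt0 := prim_order_gt0 z_prim.
have nz k : z ^+ k != 0.
  rewrite expf_neq0 //; apply/eqP => z0; move: (prim_expr_order z_prim).
  by rewrite z0 expr0n gtn_eqF // => /esym/eqP; rewrite oner_eq0.
case=> [i|] [j|] //= /eqP; rewrite ?(negPf (nz _)) //.
  rewrite (eq_prim_root_expr z_prim) !modn_small ?ltn_ord //.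
  by move=> /eqP/val_inj->.
by rewrite eq_sym (negPf (nz _)).
Qed.

(** * The code in terms of trace words *)

Section TraceDescription.

Variables (p s q m n : nat) (L : finComUnitRingType) (R : comAlgType L).
Variables (K : fieldType) (rho : {rmorphism R -> K}) (xi : R).
Variables (phi : {lrmorphism R -> R}) (b : 'I_n -> 'rV[L]_m).
Variables (T : finType) (code : R -> T).

Hypotheses (q_gt1 : (1 < q)%N) (m_gt0 : (0 < m)%N) (n_def : n.+1 = (q ^ m)%N).
Hypothesis code_inj : injective code.
Hypothesis alg_inj : forall a : L, a%:A = 0 :> R -> a = 0.
Hypothesis rho_lift : forall c, rho c != 0 -> exists d, c * d = 1.
Hypothesis rho_unit : forall a : L, rho a%:A != 0 -> a \is a GRing.unit.
Hypothesis rho_fix : forall a : L, rho a%:A ^+ q = rho a%:A.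
Hypothesis rho_xi : n.-primitive_root (rho xi).
Hypothesis xi_n : xi ^+ n = 1.
Hypothesis phi_xi : phi xi = xi ^+ q.
Hypothesis frobE : frobenius p s q n xi =1 phi.
Hypothesis xi_span :
  forall c, exists a : 'rV[L]_m, c = \sum_(l < m) a 0 l *: xi ^+ l.
Hypothesis b_coord :
  forall i : 'I_n, xi ^+ i = \sum_(l < m) b i 0 l *: xi ^+ l.

Let q_gt0 : (0 < q)%N := ltnW q_gt1.

Let pt (i : 'I_n.+1) : R := if unlift ord0 i is Some k then xi ^+ k else 0.
Let crd (i : 'I_n.+1) (l : 'I_m) : L :=
  if unlift ord0 i is Some k then b k 0 l else 0.
(** Digits as exponents: reduced monomials share the index set of the powers t^j, and the degree of
    [mon j] is the q-weight of j. *)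
Let mon (j : nat) : 'X_{1..m} := [multinom (j %/ q ^ l %% q)%N | l < m].
Let M : 'M[L]_n.+1 := \matrix_(j, i) \prod_l crd i l ^+ mon j l.
Let MR : 'M[R]_n.+1 := map_mx (in_alg R) M.

Lemma pt_crd i : pt i = \sum_l crd i l *: xi ^+ l.
Proof.
rewrite /pt /crd; case: unliftP => [k _|_]; first exact: b_coord.
by rewrite big1 // => l _; rewrite scale0r.
Qed.

Lemma pt_cases i : pt i = 0 \/ pt i ^+ n = 1.
Proof.
rewrite /pt; case: unliftP => [k _|_]; [right|by left].
by rewrite exprAC xi_n expr1n.
Qed.

Lemma rho_pt_inj : injective (rho \o pt).
Proof.
have ptE i : rho (pt i) = if unlift ord0 i is Some k then rho xi ^+ k else 0.
  by rewrite /pt; case: unlift => [k|]; rewrite ?rmorphXn ?rmorph0.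
move=> i j /=; rewrite !ptE => /(prim_root_option_inj rho_xi).
by case: (unliftP ord0 i) => [i' ->|->];
  case: (unliftP ord0 j) => [j' ->|->] // [->].
Qed.

Lemma iter_phi_sum k (I : finType) (a : I -> L) (x : I -> R) :
  iter k phi (\sum_l a l *: x l) = \sum_l a l *: iter k phi (x l).
Proof.
elim: k => //= k ->; rewrite linear_sum; apply: eq_bigr => l _.
by rewrite linearZ.
Qed.

Lemma iter_phiM k x y : iter k phi (x * y) = iter k phi x * iter k phi y.
Proof. by elim: k => //= k ->; rewrite rmorphM. Qed.

Lemma iter_phiX k l x : iter k phi (x ^+ l) = iter k phi x ^+ l.
Proof. by elim: k => //= k ->; rewrite rmorphXn. Qed.

Lemma iter_phi_xi k : iter k phi xi = xi ^+ (q ^ k).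
Proof.
by elim: k => //= k ->; rewrite rmorphXn /= phi_xi -exprM -expnS.
Qed.

(** xi^(q^m) = xi^(n+1) = xi, and the powers of xi span R over L, which [phi] fixes. *)
Lemma iter_phi_id c : iter m phi c = c.
Proof.
have [a ->] := xi_span c; rewrite iter_phi_sum; apply: eq_bigr => l _.
by rewrite iter_phiX iter_phi_xi -n_def exprS xi_n mulr1.
Qed.

Lemma iter_phi_pt i k : iter k phi (pt i) = pt i ^+ (q ^ k).
Proof.
rewrite /pt; case: unliftP => [j _|_].
  by rewrite iter_phiX iter_phi_xi exprAC.
rewrite expr0n expn_eq0 gtn_eqF // mulr0n.
by elim: k => //= k ->; rewrite rmorph0.
Qed.

Lemma pt_expn i k : pt i ^+ (q ^ k) = \sum_l crd i l *: xi ^+ (l * q ^ k).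
Proof.
rewrite -iter_phi_pt pt_crd iter_phi_sum; apply: eq_bigr => l _.
by rewrite iter_phiX iter_phi_xi mulnC exprM.
Qed.

Let D : 'M[R]_m := \matrix_(l, k) xi ^+ (l * q ^ k).

(** [D] is a Vandermonde matrix in the xi^(q^k), and these stay distinct modulo p because their
    exponents differ modulo the order n of [rho xi]. *)
Lemma conjugates_mx_inverse : exists2 B, D *m B = 1%:M & B *m D = 1%:M.
Proof.
suff /rho_lift[d] : rho (\det D) != 0.
  by case/mx_inverse_of_det => B; exists B.
have -> : D = Vandermonde m (\row_k xi ^+ (q ^ k)).
  by apply/matrixP => l k; rewrite !mxE mulnC exprM.
rewrite det_Vandermonde rmorph_prod; apply/prodf_neq0 => k _.
rewrite rmorph_prod; apply/prodf_neq0 => k' lt_kk'; rewrite !mxE rmorphB.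
rewrite !rmorphXn subr_eq0 (eq_prim_root_expr rho_xi).
(* Since k < k', q^k' is at least 2, so q^l + 2 <= 2 q^k' <= q^m = n + 1. *)
have lt_n (l : 'I_m) : (l <= k')%N -> (q ^ l < n)%N.
  move=> le_lk'; rewrite -ltnS n_def.
  have lt_k'm : (q ^ k' * q <= q ^ m)%N by rewrite -expnSr leq_pexp2l.
  have lt_1k' : (1 < q ^ k')%N.
    by rewrite -{1}(expn0 q) ltn_exp2l //; apply: leq_ltn_trans lt_kk'.
  apply: leq_trans lt_k'm; apply: (@leq_trans (q ^ k' * 2)); last first.
    by rewrite leq_mul2l q_gt1 orbT.
  by rewrite muln2 -addnn -addn2 leq_add // leq_pexp2l.
by rewrite !modn_small ?lt_n ?(ltnW lt_kk') // eqn_exp2l // gtn_eqF.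
Qed.

(* [inW d] is the R-span of the functions t ^ j, with q-weight of j at most d,
   on the point set {0, 1, xi, ..., xi ^ (n-1)}. *)
Let inW (d : nat) (v : 'I_n.+1 -> R) : Prop :=
  exists2 c : 'rV[R]_n.+1,
    forall j : 'I_n.+1, (d < qweight q m j)%N -> c 0 j = 0
    & forall i, v i = \sum_j c 0 j * pt i ^+ j.

(** * The filtration of functions by q-weight *)

Lemma inW_widen d d' v : (d <= d')%N -> inW d v -> inW d' v.
Proof.
by move=> le_d [c c0 vE]; exists c => // j lt_d;
  rewrite c0 // (leq_ltn_trans le_d).
Qed.

Lemma inW_ext d u v : u =1 v -> inW d u -> inW d v.
Proof. by move=> eq_uv [c c0 uE]; exists c => // i; rewrite -eq_uv uE. Qed.

Lemma inW_scale d a v : inW d v -> inW d (fun i => a * v i).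
Proof.
case=> c c0 vE; exists (a *: c) => [j /c0 cj|i]; first by rewrite mxE cj mulr0.
by rewrite vE mulr_sumr; apply: eq_bigr => j _; rewrite mxE mulrA.
Qed.

Lemma inW0 d : inW d (fun=> 0).
Proof. by exists 0 => [j|i]; rewrite ?mxE // big1 // => j _;
  rewrite mxE mul0r. Qed.

Lemma inW_add d u v : inW d u -> inW d v -> inW d (fun i => u i + v i).
Proof.
case=> c c0 uE [c' c'0 vE]; exists (c + c') => [j lt_d|i].
  by rewrite mxE c0 // c'0 // addr0.
by rewrite uE vE -big_split; apply: eq_bigr => j _; rewrite mxE mulrDl.
Qed.

Lemma inW_sum d (I : Type) (r : seq I) (v : I -> 'I_n.+1 -> R) :
  (forall x, inW d (v x)) -> inW d (fun i => \sum_(x <- r) v x i).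
Proof.
move=> vW; elim: r => [|x r IHr].
  by apply: inW_ext (inW0 d) => i; rewrite big_nil.
by apply: inW_ext (inW_add (vW x) IHr) => i; rewrite big_cons.
Qed.

(** Carrying reaches an exponent of q-weight at most the sum of the e k, with the same power at
    every point. *)
Lemma inW_expn (e : 'I_m -> nat) :
  inW (\sum_k e k) (fun i => pt i ^+ (\sum_k e k * q ^ k)).
Proof.
have [j [wj jE j0]] := qweight_carry e q_gt1 n_def.
exists (delta_mx 0 j) => [k lt_k|i].
  by rewrite mxE eqxx /=; case: eqP lt_k => // ->; rewrite ltnNge wj.
rewrite [RHS](bigD1 j) //= [X in _ + X]big1 => [|k neq_kj]; last first.
  by rewrite mxE (negPf neq_kj) andbF mul0r.
by rewrite mxE !eqxx mul1r addr0 (expr_mod_eq (pt_cases i) jE).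
Qed.

(** In a product of powers the digits add place by place, and [inW_expn] absorbs the carries. *)
Lemma inW_mul d d' u v :
  inW d u -> inW d' v -> inW (d + d') (fun i => u i * v i).
Proof.
case=> c c0 uE [c' c'0 vE].
apply: (@inW_ext _ (fun i => \sum_j \sum_k (c 0 j * c' 0 k) * (pt i ^+ (j + k)))).
  move=> i; rewrite uE vE mulr_suml; apply: eq_bigr => j _.
  by rewrite mulr_sumr; apply: eq_bigr => k _; rewrite exprD mulrACA.
apply: inW_sum => j; apply: inW_sum => k.
have [lt_d|le_d] := ltnP d (qweight q m j).
  by apply: inW_ext (inW0 _) => i; rewrite c0 // !mul0r.
have [lt_d'|le_d'] := ltnP d' (qweight q m k).
  by apply: inW_ext (inW0 _) => i; rewrite c'0 // mulr0 mul0r.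
apply: inW_scale; apply: inW_widen (leq_add le_d le_d') _.
rewrite /qweight -big_split /=.
have lt_expn (i : 'I_n.+1) : (i < q ^ m)%N by rewrite -n_def.
rewrite -{2}(sum_digits q_gt0 (lt_expn j)) -{2}(sum_digits q_gt0 (lt_expn k)).
rewrite -big_split /=.
apply: inW_ext (inW_expn _) => i /=; congr (_ ^+ _); apply: eq_bigr => l _.
by rewrite mulnDl.
Qed.

Lemma inW_one : inW 0 (fun=> 1).
Proof. by have := inW_expn (fun=> 0%N); rewrite !big1. Qed.

(** The row of conjugates t^(q^k) is the row of coordinates times [D]; inverting [D] writes each
    coordinate through powers of q-weight 1. *)
Lemma inW_crd l : inW 1 (fun i => (crd i l)%:A).
Proof.
have [B DB _] := conjugates_mx_inverse.
have crdE i : (crd i l)%:A = \sum_(k < m) pt i ^+ (q ^ k) * B k l.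
  have E : (\row_l (crd i l)%:A) *m D = \row_(k < m) pt i ^+ (q ^ k).
    apply/rowP => k; rewrite !mxE pt_expn; apply: eq_bigr => l' _.
    by rewrite !mxE mulr_algl.
  have := congr1 (mulmx^~ B) E; rewrite -mulmxA DB mulmx1.
  move=> /matrixP/(_ 0 l); rewrite !mxE => ->.
  by apply: eq_bigr => k _; rewrite !mxE.
apply: (@inW_ext _ (fun i => \sum_(k < m) B k l * pt i ^+ (q ^ k))) => [i|].
  by rewrite crdE; apply: eq_bigr => k _; rewrite mulrC.
apply: inW_sum => k; apply: inW_scale.
have := inW_expn (fun i => (i == k) : nat).
rewrite (bigD1 k) //= eqxx big1 ?addn0 => [|i /negPf->//].
rewrite (bigD1 k) //= eqxx mul1n big1 ?addn0 // => i /negPf->.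
by rewrite mul0n.
Qed.

Lemma inW_prod (e : 'I_m -> nat) (v : 'I_m -> 'I_n.+1 -> R) :
  (forall l, inW 1 (v l)) ->
  inW (\sum_l e l) (fun i => \prod_l v l i ^+ e l).
Proof.
have inW_exp d u k : inW d u -> inW (k * d) (fun i => u i ^+ k).
  move=> uW; elim: k => [|k IHk]; first exact: inW_one.
  by apply: inW_ext (inW_mul uW IHk) => i; rewrite exprS.
move=> vW; elim: (index_enum _) => [|l r IHr].
  by rewrite big_nil; apply: inW_ext inW_one => i; rewrite big_nil.
rewrite big_cons; have := inW_mul (inW_exp _ _ (e l) (vW l)) IHr.
by rewrite muln1; apply: inW_ext => i; rewrite big_cons.
Qed.

Lemma inW_mon j :
  inW (qweight q m j) (fun i => (\prod_l crd i l ^+ mon j l)%:A).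
Proof.
apply: inW_ext (inW_prod _ inW_crd) => i /=.
rewrite -in_algE rmorph_prod; apply: eq_bigr => l _.
by rewrite mnmE rmorphXn.
Qed.

(** t^(j q^k) is a product of factors t^(q^(l+k)), one per unit of the digit l of j, and each is
    linear in the coordinates, even when l + k >= m. *)
Lemma inW_conj (j : 'I_n.+1) k :
  inW (qweight q m j) (fun i => pt i ^+ (j * q ^ k)).
Proof.
have lin l : inW 1 (fun i => pt i ^+ (q ^ l)).
  apply: (@inW_ext _ (fun i => \sum_(k < m) xi ^+ (k * q ^ l) * (crd i k)%:A)).
    by move=> i; rewrite pt_expn; apply: eq_bigr => k' _; rewrite mulr_algr.
  by apply: inW_sum => k'; apply/inW_scale/inW_crd.
apply: inW_ext (inW_prod _ (fun l : 'I_m => lin (l + k)%N)) => i /=.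
have lt_j : (j < q ^ m)%N by rewrite -n_def.
rewrite -{2}(sum_digits q_gt0 lt_j) big_distrl expr_sum.
by apply: eq_bigr => l _; rewrite -exprM expnD mulnC mulnA.
Qed.

(** * Independence of the reduced monomials modulo p *)

Lemma rho_alg_expn (x c : L) :
  1 - (rho x%:A - rho c%:A) ^+ q.-1 = (rho x%:A == rho c%:A)%:R.
Proof.
rewrite -subr_eq0 -rmorphB -scalerBl.
have [->|nz] := eqVneq;
  first by rewrite expr0n -subn1 subn_eq0 leqNgt q_gt1 subr0.
have := rho_fix (x - c);
  rewrite -{1}(prednK q_gt0) exprS => /(canRL (mulKf nz)).
by rewrite mulVf // => ->; rewrite subrr.
Qed.

(* Modulo p, 1 - (x - c)^(q-1) is the indicator function of c on F_q. *)
Lemma M_unit : M \in unitmx.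
Proof.
pose sigma (a : L) : K := rho (in_alg R a).
pose ind i l := 1 - ('X - (sigma (crd i l))%:P) ^+ q.-1.
(* Row i holds the coefficients, on reduced monomials, of the indicator polynomial of point i, so
   that [N] inverts [M] modulo p. *)
pose N : 'M[K]_n.+1 := \matrix_(i, j) \prod_l (ind i l)`_(mon j l).
have size_ind i l : (size (ind i l) <= q)%N.
  rewrite /ind (leq_trans (size_polyD _ _)) // geq_max size_poly1 q_gt0 size_polyN.
  by rewrite size_exp_XsubC prednK // ?leqnn.
have NM : N *m map_mx (rho \o in_alg R) M = 1%:M.
  apply/matrixP => i i'; rewrite !mxE.
  under eq_bigr => j _.
    rewrite !mxE rmorph_prod -big_split.
    under eq_bigr => l _ do rewrite rmorphXn mnmE.
    over.
  rewrite (sum_prod_digits (fun l e => (ind i l)`_e * sigma (crd i' l) ^+ e)) //.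
  under eq_bigr => l _.
    rewrite -horner_coef_wide // hornerD hornerN hornerC horner_exp hornerXsubC.
    rewrite rho_alg_expn.
    over.
  have [<-|neq_ii'] := eqVneq i i'; first by rewrite big1 // => l _;
    rewrite eqxx.
  (* Distinct points have distinct residues, so some coordinate separates them modulo p. *)
  have [l /negPf neq_l|eq_l] := pickP (fun l => sigma (crd i' l) != sigma (crd i l)).
    by rewrite (bigD1 l) //= neq_l mul0r.
  case/eqP: neq_ii'; apply: rho_pt_inj; rewrite /= !pt_crd !rmorph_sum.
  apply: eq_bigr => l _.
  rewrite -(mulr_algl (crd i l)) -(mulr_algl (crd i' l)) !rmorphM;
    congr (_ * _).
  by apply/esym/eqP/negbFE/eq_l.
rewrite unitmxE; apply: rho_unit; apply/eqP => det0.
have /(congr1 determinant) := NM;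
  rewrite det_mulmx det1 det_map_mx /= det0 mulr0.
by move/esym/eqP; rewrite oner_eq0.
Qed.

Lemma MR_inverse : exists2 B, MR *m B = 1%:M & B *m MR = 1%:M.
Proof.
exists (map_mx (in_alg R) (invmx M)).
  by rewrite -map_mxM mulmxV ?M_unit // map_mx1.
by rewrite -map_mxM mulVmx ?M_unit // map_mx1.
Qed.

(** The matrix [AM], writing monomials through powers, acts injectively on coefficient rows and
    preserves those supported on q-weight at most nu. As R is finite, y returns to itself under
    iteration: y = f (f^k y), and f^k y is the required row of monomial coefficients. *)
Lemma inW_span nu v : inW nu v ->
  exists2 a : 'rV[R]_n.+1,
    forall j : 'I_n.+1, (nu < qweight q m j)%N -> a 0 j = 0
    & forall i, v i = \sum_j a 0 j * (M j i)%:A.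
Proof.
case=> y y0 vE.
have [A AP] : exists A : 'I_n.+1 -> 'rV[R]_n.+1, forall j : 'I_n.+1,
    (forall k : 'I_n.+1, (qweight q m j < qweight q m k)%N -> A j 0 k = 0) /\
    (forall i, (M j i)%:A = \sum_k A j 0 k * pt i ^+ k).
  have /fin_all_exists[A AP] : forall j : 'I_n.+1, exists c : 'rV[R]_n.+1,
      (forall k : 'I_n.+1, (qweight q m j < qweight q m k)%N -> c 0 k = 0) /\
      (forall i, (M j i)%:A = \sum_k c 0 k * pt i ^+ k).
    by move=> j; have [c c0 cE] := inW_mon j; exists c; split=> // i;
      rewrite mxE cE.
  by exists A.
pose V : 'M[R]_n.+1 := \matrix_(j, i) pt i ^+ j.
pose AM : 'M[R]_n.+1 := \matrix_(j, k) A j 0 k.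
have AV : AM *m V = MR.
  apply/matrixP => j i; rewrite [RHS]mxE [LHS]mxE in_algE (proj2 (AP j)).
  by apply: eq_bigr => k _; rewrite !mxE.
pose f (c : 'rV[R]_n.+1) := c *m AM.
have f_inj : injective f.
  have [B MB _] := MR_inverse; move=> c c' /(congr1 (mulmx^~ (V *m B))).
  by rewrite /f -!mulmxA !(mulmxA AM) AV MB !mulmx1.
have f_stable k (c : 'rV[R]_n.+1) :
    (forall j : 'I_n.+1, (nu < qweight q m j)%N -> c 0 j = 0) ->
    forall j : 'I_n.+1, (nu < qweight q m j)%N -> (iter k f c) 0 j = 0.
  move=> c0; elim: k => //= k IHk j lt_j; rewrite mxE big1 // => l _;
    rewrite mxE.
  have [lt_l|le_l] := ltnP nu (qweight q m l); first by rewrite IHk // mul0r.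
  by rewrite (proj1 (AP l)) ?mulr0 // (leq_ltn_trans le_l).
have code_rV_inj : injective (fun c : 'rV[R]_n.+1 => [ffun j => code (c 0 j)]).
  by move=> c c' /ffunP eq_c; apply/rowP => j; have := eq_c j;
    rewrite !ffunE => /code_inj.
have [k fk] := inj_periodic y code_rV_inj f_inj.
exists (iter k f y) => [|i]; first exact: f_stable.
transitivity ((y *m V) 0 i); first by rewrite vE mxE; apply: eq_bigr => j _;
  rewrite mxE.
by rewrite -{1}fk /= /f -mulmxA AV mxE; apply: eq_bigr => j _;
  rewrite [MR _ _]mxE.
Qed.

(** * The relative trace *)

Let tr (c : R) : L := rel_trace p s q m n xi c.

(* In the basis of powers of xi, multiplication by c has a matrix over L which D
   conjugates into the diagonal matrix of the conjugates of c. *)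
Lemma rel_traceE c : (tr c)%:A = \sum_(k < m) iter k phi c.
Proof.
have sumE : \sum_(k < m) iter k (frobenius p s q n xi) c = \sum_(k < m) iter k phi c.
  by apply: eq_bigr => k _; apply: eq_iter.
(* The default value of [rel_trace] is excluded by a witness in L: the trace of the matrix of
   multiplication by c. *)
rewrite /tr /rel_trace sumE; case: pickP => [a /eqP //|no_trace].
have /fin_all_exists[N NP] : forall l : 'I_m, exists a : 'rV[L]_m,
    xi ^+ l * c = \sum_(k < m) a 0 k *: xi ^+ k.
  by move=> l; apply: xi_span.
pose A : 'M[L]_m := \matrix_(l, k) N l 0 k.
suff trA : (\tr A)%:A = \sum_(k < m) iter k phi c.
  by have := no_trace (\tr A); rewrite trA eqxx.
have [B DB BD] := conjugates_mx_inverse.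
have AD : map_mx (in_alg R) A *m D = D *m diag_mx (\row_k iter k phi c).
  apply/matrixP => l k; rewrite mul_mx_diag !mxE.
  have := congr1 (iter k phi) (NP l).
  rewrite iter_phiM iter_phiX iter_phi_xi iter_phi_sum -exprM mulnC => ->.
  apply: eq_bigr => l' _; rewrite !mxE mulr_algl iter_phiX iter_phi_xi -exprM.
  by rewrite mulnC.
rewrite -in_algE -trace_map_mx -[map_mx _ _]mulmx1 -DB mulmxA AD mxtrace_mulC.
rewrite mulmxA BD mul1mx mxtrace_diag.
by apply: eq_bigr => k _; rewrite mxE.
Qed.

Let alg_injective : injective (in_alg R).
Proof. by apply: raddf_inj; apply: alg_inj. Qed.

Lemma rel_trace_sum (I : finType) (a : I -> L) (x : I -> R) :
  tr (\sum_i a i *: x i) = \sum_i a i * tr (x i).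
Proof.
apply: alg_injective; rewrite rmorph_sum !in_algE rel_traceE.
under eq_bigr do rewrite iter_phi_sum.
rewrite exchange_big; apply: eq_bigr => i _.
by rewrite -scaler_sumr -rel_traceE scalerA.
Qed.

Lemma rel_trace_alg x a : tr (x * a%:A) = a * tr x.
Proof.
have := rel_trace_sum (fun _ : 'I_1 => a) (fun=> x); rewrite !big_ord1 => <-.
by rewrite mulr_algr.
Qed.

Lemma rel_traceD (I : finType) (x : I -> R) : tr (\sum_i x i) = \sum_i tr (x i).
Proof.
have := rel_trace_sum (fun=> 1) x; under eq_bigr do rewrite scale1r.
by move=> ->; apply: eq_bigr => i _; rewrite mul1r.
Qed.

Lemma rel_trace0 : tr 0 = 0.
Proof. by have := rel_trace_alg 0 0; rewrite mul0r mul0r. Qed.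

(** [phi] permutes the m conjugates cyclically, by [iter_phi_id]. *)
Lemma rel_trace_iter k c : tr (iter k phi c) = tr c.
Proof.
elim: k => //= k <-; move: (iter k phi c) => {k}c.
apply: alg_injective; rewrite !in_algE !rel_traceE.
under eq_bigr do rewrite -iterSr.
case: (m) m_gt0 iter_phi_id => // m' _ phi_m.
by rewrite big_ord_recr [RHS]big_ord_recl phi_m addrC; congr (_ + _).
Qed.

(** If every tr (xi^l) vanished modulo p, the invertible [D] would kill the all-ones column modulo
    p. So one of these values is a unit, and L-linearity scales it to 1. *)
Lemma rel_trace_one : exists c, tr c = 1.
Proof.
suff [l nz] : exists l : 'I_m, rho (tr (xi ^+ l))%:A != 0.
  have u := rho_unit nz; exists (xi ^+ l * (tr (xi ^+ l))^-1%:A).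
  by rewrite rel_trace_alg mulVr.
apply/existsP; rewrite -[X in is_true X]negbK negb_exists;
  apply/negP => /forallP trace0.
have [B _ BD] := conjugates_mx_inverse; pose k0 := Ordinal m_gt0.
pose w : 'cV[R]_m := \col_l (tr (xi ^+ l))%:A.
have wE : D *m const_mx 1 = w.
  apply/colP => l; rewrite !mxE rel_traceE; apply: eq_bigr => k _.
  by rewrite !mxE mulr1 iter_phiX iter_phi_xi -exprM mulnC.
have := congr1 (fun v : 'cV_m => rho (v k0 0)) (congr1 (mulmx B) wE).
rewrite mulmxA BD mul1mx !mxE rmorph1 rmorph_sum big1; last first.
  by move=> l _; rewrite rmorphM mxE (eqP (negbNE (trace0 l))) mulr0.
by move/eqP; rewrite oner_eq0.
Qed.

(** * Words of the Reed-Muller code as combinations of the rows of [M] *)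

Lemma RM_coef d c : RM q b d c <->
  exists2 a : 'rV[L]_n.+1,
    forall j : 'I_n.+1, (d < qweight q m j)%N -> a 0 j = 0
    & forall i, c 0 i = \sum_j a 0 j * M j i.
Proof.
have mon_inj : injective (fun j : 'I_n.+1 => mon j).
  move=> i j /mnmP eq_ij; apply: (@mon_digits_inj q m) => // l.
  by have := eq_ij l; rewrite !mnmE.
have mdeg_mon j : mdeg (mon j) = qweight q m j.
  by rewrite mdegE /qweight; apply: eq_bigr => l _; rewrite mnmE.
split=> [[P [redP sizeP ->]]|[a a0 cE]].
  exists (\row_j P@_(mon j)) => [j lt_j|i].
    rewrite mxE; apply: memN_msupp_eq0; apply: msize_mdeg_ge.
    by rewrite mdeg_mon (leq_trans sizeP).
  have PE : P = \sum_(j < n.+1) P@_(mon j) *: 'X_[mon j].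
    apply/mpolyP => k; rewrite linear_sum /=.
    under eq_bigr do rewrite mcoeffZ mcoeffX.
    have [k_supp|k_nsupp] := boolP (k \in msupp P).
      (* A reduced exponent vector is the digit vector of the number it represents in base q. *)
      have lt_q l : (k l < q)%N by rewrite -(prednK q_gt0) ltnS redP.
      have lt_n : (\sum_l k l * q ^ l < n.+1)%N by rewrite n_def sum_expn_lt.
      have kE : mon (Ordinal lt_n) = k.
        by apply/mnmP => l; rewrite mnmE /= digit_sum_expn.
      rewrite (bigD1 (Ordinal lt_n)) //= [mon _]kE eqxx mulr1 big1 ?addr0 // => j.
      by rewrite -{2}kE (inj_eq mon_inj) => /negPf->; rewrite mulr0.
    rewrite memN_msupp_eq0 // big1 // => j _.
    by case: eqP => [->|_]; rewrite ?mulr0 // memN_msupp_eq0 // mul0r.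
  rewrite mxE {1}PE raddf_sum; apply: eq_bigr => j _.
  by rewrite /= mevalZ mevalX !mxE.
have supp k : k \in msupp (\sum_(j < n.+1) a 0 j *: 'X_[mon j]) ->
    exists2 j : 'I_n.+1, a 0 j != 0 & k = mon j.
  rewrite mcoeff_msupp linear_sum /=.
  have [j /andP[aj /eqP kj] _|no_j] :=
      pickP (fun j : 'I_n.+1 => (a 0 j != 0) && (k == mon j)).
    by exists j.
  rewrite big1 ?eqxx // => j _; rewrite mcoeffZ mcoeffX.
  case: (mon j =P k) (no_j j) => [->|_ _]; last by rewrite mulr0.
  by rewrite eqxx andbT => /negbFE/eqP->; rewrite mul0r.
exists (\sum_(j < n.+1) a 0 j *: 'X_[mon j]); split.
- move=> k /supp[j _ ->] l; rewrite mnmE -ltnS prednK //.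
  by rewrite ltn_pmod.
- rewrite msizeE; apply/bigmax_leqP_seq => k /supp[j aj ->] _.
  rewrite ltnS mdeg_mon leqNgt; apply: contra aj => lt_j.
  by rewrite a0.
- apply/rowP => i; rewrite cE mxE raddf_sum; apply: eq_bigr => j _.
  by rewrite /= mevalZ mevalX !mxE.
Qed.

Lemma RM_widen d d' c : (d <= d')%N -> RM q b d c -> RM q b d' c.
Proof.
move=> le_d /RM_coef[a a0 cE]; apply/RM_coef; exists a => // j lt_j.
by rewrite a0 // (leq_ltn_trans le_d).
Qed.

Lemma RM_lincomb d k (a : 'I_k -> L) (v : 'I_k -> 'rV[L]_n.+1) :
  (forall x, RM q b d (v x)) -> RM q b d (\sum_x a x *: v x).
Proof.
move=> vRM.
have /fin_all_exists[y yP] : forall x, exists y : 'rV[L]_n.+1,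
    (forall j : 'I_n.+1, (d < qweight q m j)%N -> y 0 j = 0)
    /\ (forall i, v x 0 i = \sum_j y 0 j * M j i).
  by move=> x; have /RM_coef[y y0 yE] := vRM x; exists y.
apply/RM_coef; exists (\sum_x a x *: y x) => [j lt_j|i].
  rewrite summxE big1 // => x _; have [y0 _] := yP x.
  by rewrite mxE y0 // mulr0.
rewrite summxE; under [RHS]eq_bigr do rewrite summxE mulr_suml.
rewrite exchange_big; apply: eq_bigr => x _; have [_ yE] := yP x.
by rewrite mxE yE mulr_sumr; apply: eq_bigr => j _;
  rewrite [(a x *: y x) _ _]mxE mulrA.
Qed.

Lemma RM_const a : RM q b 0 (\row_i a).
Proof.
have w0 : qweight q m 0 = 0%N by rewrite /qweight big1 // => l _;
  rewrite div0n mod0n.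
apply/RM_coef; exists (a *: delta_mx 0 0) => [j lt_j|i].
  rewrite !mxE eqxx /=; case: eqP lt_j => [->|_ _]; last by rewrite mulr0.
  by rewrite w0.
rewrite mxE [RHS](bigD1 0) //= [X in _ + X]big1 => [|j /negPf nz]; last first.
  by rewrite !mxE nz andbF mulr0 mul0r.
rewrite !mxE !eqxx mulr1 addr0 big1 ?mulr1 // => l _.
by rewrite mnmE div0n mod0n.
Qed.

(** For j = 0 the infinity coordinates would disagree: it is 0 in the trace word, while 0^0 = 1
    gives tr lambda. *)
Lemma trace_wordE j lambda i : (0 < j)%N ->
  trace_word p s q m n xi j lambda 0 i = tr (lambda * pt i ^+ j).
Proof.
move=> j_gt0; rewrite mxE /pt; case: unliftP => [k _|_]; first by rewrite exprM.
by rewrite expr0n gtn_eqF // mulr0 rel_trace0.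
Qed.

Lemma RM_trace_word (j : 'I_n.+1) lambda : (0 < j)%N ->
  RM q b (qweight q m j) (trace_word p s q m n xi j lambda).
Proof.
move=> j_gt0; have [c0 trc0] := rel_trace_one.
set v := trace_word _ _ _ _ _ _ _ _.
have /inW_span[a a0 vE] : inW (qweight q m j) (fun i => (v 0 i)%:A).
  apply: (@inW_ext _ (fun i =>
    \sum_(k < m) iter k phi lambda * pt i ^+ (j * q ^ k))) => [i|].
    rewrite trace_wordE // rel_traceE; apply: eq_bigr => k _.
    by rewrite iter_phiM iter_phiX iter_phi_pt mulnC exprM.
  by apply: inW_sum => k; apply/inW_scale/inW_conj.
(* The monomials take values in L, so tr (c0 .) acts on the coefficients alone: it moves them from R
   to L and fixes the word. *)
apply/RM_coef; exists (\row_j tr (c0 * a 0 j)) => [k lt_k|i].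
  by rewrite mxE a0 // mulr0 rel_trace0.
transitivity (tr (c0 * (v 0 i)%:A)); first by rewrite rel_trace_alg trc0 mulr1.
rewrite vE mulr_sumr rel_traceD; apply: eq_bigr => k _.
by rewrite mulrA rel_trace_alg mxE mulrC.
Qed.

Lemma RM_generated nu (J : {set 'I_n.+1})
    (J_repr : coset_representatives q m nu J) c :
  RM q b nu c <->
  generated_by
    (fun v => RM q b 0 v \/
       exists (j : 'I_n.+1) (lambda : R),
         j \in J /\ v = trace_word p s q m n xi j lambda) c.
Proof.
have [J_sub J_meet] := J_repr.
split=> [/RM_coef[a a0 cE]|[k [a [v [vS ->]]]]]; last first.
  apply: RM_lincomb => x; have [|[j [lambda [/J_sub[j_gt0 le_j] ->]]]] := vS x.
    exact: RM_widen.
  exact: RM_widen (RM_trace_word _ j_gt0).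
have [c0 trc0] := rel_trace_one.
have [y y0 yE] : inW nu (fun i => (c 0 i)%:A).
  apply: (@inW_ext _ (fun i => \sum_j (a 0 j)%:A * (M j i)%:A)) => [i|].
    rewrite cE -in_algE rmorph_sum; apply: eq_bigr => j _.
    by rewrite -!in_algE rmorphM.
  apply: inW_sum => j; have [lt_j|le_j] := ltnP nu (qweight q m j).
    by apply: inW_ext (inW0 _) => i; rewrite a0 // scale0r mul0r.
  apply: inW_scale; apply: inW_widen le_j _.
  by apply: inW_ext (inW_mon j) => i; rewrite mxE.
(* The terms of the expansion of c in powers t^j, after applying tr (c0 .); they add up to c. *)
pose v (j : 'I_n.+1) : 'rV[L]_n.+1 := \row_i tr (c0 * y 0 j * pt i ^+ j).
exists n.+1, (fun=> 1), v; split; last first.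
  apply/rowP => i; rewrite summxE.
  transitivity (tr (c0 * (c 0 i)%:A));
    first by rewrite rel_trace_alg trc0 mulr1.
  rewrite yE mulr_sumr rel_traceD; apply: eq_bigr => j _.
  by rewrite !mxE mul1r mulrA.
move=> j; have [lt_j|le_j] := ltnP nu (qweight q m j).
  left; have := RM_const 0; congr (RM _ _ _ _); apply/rowP => i.
  by rewrite !mxE y0 // mulr0 mul0r rel_trace0.
(* Exponent 0 lies in no coset; its term is a constant word, supplied by the repetition code. *)
have [j0|j_gt0] := posnP j.
  left; have := RM_const (tr (c0 * y 0 j)); congr (RM _ _ _ _); apply/rowP => i.
  by rewrite !mxE j0 mulr1.
right; have /eqP/cards1P[j' J'E] := J_meet j j_gt0 le_j.
have : j' \in J :&: cyclotomic_coset q m n j by rewrite J'E set11.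
rewrite !inE => /and3P[Jj' j'_gt0 /existsP[k /eqP j'E]].
(* The representative j' is congruent to j q^k, so applying [phi] k times inside the trace turns
   exponent j into j' and transforms the coefficient accordingly. *)
exists j', (iter k phi (c0 * y 0 j)); split=> //; apply/rowP => i.
rewrite trace_wordE // mxE -(rel_trace_iter k) iter_phiM iter_phiX;
  congr (tr (_ * _)).
rewrite iter_phi_pt -exprM mulnC.
apply/esym/expr_mod_eq; [exact: pt_cases | exact: j'E |].
by rewrite !gtn_eqF // muln_gt0 j_gt0 expn_gt0 q_gt0.
Qed.

End TraceDescription.

(** * The Frobenius automorphism of a quotient by a basic primitive polynomial *)

Section QpolyLift.

Variables (L : comNzRingType) (h : {poly L}) (S : nzRingType).
Variable G : {rmorphism {poly L} -> S}.
Hypotheses (h_monic : h \is monic) (h_size : (1 < size h)%N) (Gh : G h = 0).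

(** The proofs are arguments of the map so that its morphism structure can be inferred from the term
    itself. *)
Definition qpoly_lift of h \is monic & (1 < size h)%N & G h = 0 :=
  fun c : {poly %/ h} => G (val c).

Local Notation lift := (qpoly_lift h_monic h_size Gh).

Lemma qpoly_liftE u : lift (in_qpoly h u) = G u.
Proof.
(* [{poly %/ h}] is the quotient by [mk_monic h], which is h for a monic nonconstant h. *)
have hE : mk_monic h = h by rewrite /mk_monic h_size h_monic.
rewrite /qpoly_lift /= hE [in RHS](Pdiv.RingMonic.rdivp_eq h_monic u).
by rewrite rmorphD rmorphM Gh mulr0 add0r.
Qed.

Lemma in_qpoly_val (c : {poly %/ h}) : in_qpoly h (val c) = c.
Proof. by apply: val_inj; apply: in_qpoly_small (size_mk_monic c). Qed.

Fact qpoly_lift_zmod : zmod_morphism lift.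
Proof. by move=> c d; apply: (rmorphB G (val c) (val d)). Qed.

Fact qpoly_lift_monoid : monoid_morphism lift.
Proof.
split; first exact: (rmorph1 G).
by move=> c d;
  rewrite -{1}(in_qpoly_val c) -{1}(in_qpoly_val d) -rmorphM qpoly_liftE rmorphM.
Qed.

HB.instance Definition _ :=
  GRing.isZmodMorphism.Build {poly %/ h} S lift qpoly_lift_zmod.
HB.instance Definition _ :=
  GRing.isMonoidMorphism.Build {poly %/ h} S lift qpoly_lift_monoid.

End QpolyLift.

(** If z = 1 modulo p, then in z^p - 1 = (z - 1)(1 + z + ... + z^(p-1)) the second factor is a
    multiple of p, so each p-th power gains one factor p. *)
Lemma expr_adic (R : comNzRingType) p (x c : R) k : x = 1 + p%:R * c ->
  exists d, x ^+ (p ^ k) = 1 + p%:R ^+ k.+1 * d.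
Proof.
have pow (z d : R) i : z = 1 + p%:R * d -> exists e, z ^+ i = 1 + p%:R * e.
  move=> ->; elim: i => [|i [e IHi]]; first by exists 0; rewrite mulr0 addr0.
  by exists (d + (1 + p%:R * d) * e); rewrite exprS IHi; ring.
move=> xE; elim: k => [|k [d IHk]]; first by exists c.
rewrite expnSr exprM; set z := x ^+ _ in IHk *.
have /fin_all_exists[e eE] : forall i : 'I_p, exists e, z ^+ i = 1 + p%:R * e.
  by move=> i; apply: (@pow _ (p%:R ^+ k * d)); rewrite mulrA -exprS.
exists (d * (1 + \sum_i e i)); apply/eqP; rewrite addrC -subr_eq subrX1.
under eq_bigr do rewrite eE.
have -> : z - 1 = p%:R ^+ k.+1 * d by rewrite IHk addrC addKr.
rewrite big_split /= sumr_const card_ord -mulr_sumr; apply/eqP.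
by rewrite [in RHS]exprS; ring.
Qed.

(** * Reduction of L[x]/(h) to its residue field *)

Section Residue.

Variables (p s r q m n : nat).
Hypotheses (p_prime : prime p) (r_gt0 : (0 < r)%N) (m_gt0 : (0 < m)%N).
Hypotheses (q_def : q = (p ^ r)%N) (n_def : n = (q ^ m).-1).
Variables (L : finComUnitRingType) (L_galois : galois_ring p s r L).
Variables (F : finFieldType) (red : {rmorphism L -> F}).
Hypothesis red_mod : reduction_mod p red.
Variable h : {poly L}.
Hypotheses (h_primitive : basic_primitive red h) (h_size : size h = m.+1).
Hypothesis h_dvd : exists g : {poly L}, 'X^n - 1 = g * h.
Variable xi : {poly %/ h}.
Hypothesis xi_root : root (map_poly (in_alg {poly %/ h}) h) xi.
Hypothesis xi_order : n.-primitive_root xi.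

Local Notation R := {poly %/ h}.

Lemma card_expn : n.+1 = (q ^ m)%N.
Proof. by rewrite n_def prednK // expn_gt0 q_def expn_gt0 prime_gt0. Qed.

Let h_monic : h \is monic. Proof. by case: h_primitive. Qed.
Let h_size_gt1 : (1 < size h)%N. Proof. by rewrite h_size ltnS. Qed.

Let hbar := map_poly red h.
Let hbar_primitive : primitive_poly hbar. Proof. by case: h_primitive. Qed.
Let hbar_mi : monic_irreducible_poly hbar := primitive_mi hbar_primitive.
Local Notation K := {poly %/ hbar with hbar_mi}.

Lemma residue_size : size hbar = m.+1.
Proof. by rewrite size_map_poly_id0 // (monicP h_monic) rmorph1 oner_neq0. Qed.

Let residue_poly : {rmorphism {poly L} -> K} := in_qpoly hbar \o map_poly red.

Lemma residue_poly_h : residue_poly h = 0.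
Proof.
apply: val_inj => /=; rewrite (mk_monicE hbar_mi).
by rewrite Pdiv.RingMonic.rmodpp //; case: hbar_mi.
Qed.

Let rho : {rmorphism R -> K} := qpoly_lift h_monic h_size_gt1 residue_poly_h.

Lemma rhoE u : rho (in_qpoly h u) = residue_poly u.
Proof. exact: qpoly_liftE. Qed.

Lemma red_p : red p%:R = 0.
Proof. by case: red_mod => _ /(_ p%:R)[_]; apply; exists 1; rewrite mulr1. Qed.

Lemma rho_p : rho p%:R = 0.
Proof.
rewrite -(rmorph_nat (in_qpoly h)) rhoE /= -polyC_natr map_polyC /= red_p.
by rewrite in_qpoly0.
Qed.

Lemma p_nilpotent : p%:R ^+ s = 0 :> R.
Proof.
have [/(_ (p ^ s)%N)[_ /(_ (dvdnn _)) ps0] _ _] := L_galois.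
by rewrite -natrX -(rmorph_nat (in_alg R)) ps0 rmorph0.
Qed.

Lemma alg_qpoly_inj (a : L) : a%:A = 0 :> R -> a = 0.
Proof.
move=> /(congr1 (fun c : R => (val c)`_0)) /=.
by rewrite coefZ coefC mulr1 coef0.
Qed.

Lemma rho_surj z : exists c, rho c = z.
Proof.
have [red_surj _] := red_mod.
pose lift (x : F) : L := odflt 0 [pick y | red y == x].
have liftE x : red (lift x) = x.
  rewrite /lift; case: pickP => [y /eqP //|no_y].
  by have [y yx] := red_surj x; move: (no_y y); rewrite yx eqxx.
pose u := \poly_(i < size (val z)) lift (val z)`_i.
exists (in_qpoly h u); rewrite rhoE /= -[RHS]in_qpoly_val; congr in_qpoly.
apply/polyP => i; rewrite coef_map coef_poly.
by case: ltnP => [_|le_i]; [exact: liftE | rewrite raddf0 nth_default].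
Qed.

Lemma rho_eq0 c : rho c = 0 -> exists d, c = p%:R * d.
Proof.
move=> c0; have hE : size (mk_monic h) = m.+1.
  by rewrite /mk_monic h_size_gt1 h_monic.
have val_red : map_poly red (val c) = 0.
  (* The representative of c has degree below m, the degree of [hbar], so after reducing its
     coefficients no division by [hbar] takes place. *)
  have /(congr1 val) := c0; rewrite /= Pdiv.Ring.rmodp_small //.
  rewrite (mk_monicE hbar_mi) residue_size.
  apply: leq_ltn_trans (size_poly _ _) _.
  by rewrite -hE size_mk_monic.
pose divp (x : L) : L := odflt 0 [pick y | x == p%:R * y].
have divpE i : (val c)`_i = p%:R * divp (val c)`_i.
  rewrite /divp; case: pickP => [y /eqP //|no_y].
  have : red (val c)`_i = 0 by rewrite -coef_map val_red coef0.
  by case: red_mod => _ /(_ (val c)`_i)[+ _] => /[apply] -[y /eqP];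
    rewrite no_y.
exists (in_qpoly h (\poly_(i < size (val c)) divp (val c)`_i)).
rewrite -{1}[c]in_qpoly_val -(rmorph_nat (in_qpoly h)) -rmorphM; congr in_qpoly.
apply/polyP => i; rewrite -polyC_natr coefCM coef_poly.
by case: ltnP => [_|le_i]; rewrite // mulr0 nth_default.
Qed.

(** A lift d of the residual inverse gives c d = 1 - p e, which the geometric series inverts because
    p is nilpotent. *)
Lemma rho_inverse c : rho c != 0 -> exists d, c * d = 1.
Proof.
move=> nz; have [d dE] := rho_surj (rho c)^-1.
have [e eE] : exists e, 1 - c * d = p%:R * e.
  by apply: rho_eq0; rewrite rmorphB rmorph1 rmorphM dE mulfV // subrr.
exists (d * \sum_(i < s) (p%:R * e) ^+ i); rewrite mulrA.
have -> : c * d = - (p%:R * e - 1) by rewrite -eE; ring.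
by rewrite mulNr -subrX1 exprMn p_nilpotent mul0r sub0r opprK.
Qed.

Lemma rho_alg_unit (a : L) : rho a%:A != 0 -> a \is a GRing.unit.
Proof.
apply: contraNT; case: L_galois => _ _ /(_ a)[+ _] => /[apply] -[y ->].
by rewrite -in_algE rmorphM rmorph_nat rmorphM rho_p mul0r.
Qed.

Lemma coprime_np : coprime n p.
Proof.
have : coprime n (n.+1) by apply: coprimenS.
by rewrite card_expn q_def !coprime_pexpr.
Qed.

(** If [rho xi] has order d, then xi^d = 1 modulo p and xi^(d p^s) = 1 by [expr_adic]. Hence n
    divides d p^s, and being prime to p it divides d. *)
Lemma rho_xi_order : n.-primitive_root (rho xi).
Proof.
have n_gt0 := prim_order_gt0 xi_order.
have [|d d_prim dvd_dn] := prim_order_exists n_gt0 (_ : rho xi ^+ n = 1).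
  by rewrite -rmorphXn (prim_expr_order xi_order) rmorph1.
have [c cE] : exists c, xi ^+ d - 1 = p%:R * c.
  by apply: rho_eq0;
    rewrite rmorphB rmorphXn rmorph1 (prim_expr_order d_prim) subrr.
have [|e] := @expr_adic _ p (xi ^+ d) c s; first by rewrite -cE addrC subrK.
rewrite exprS p_nilpotent mulr0 mul0r addr0 -exprM => /eqP.
rewrite -(prim_order_dvd xi_order) Gauss_dvdl ?coprimeXr ?coprime_np // => dvd_nd.
by have /eqP <- : d == n by rewrite eqn_dvd dvd_dn dvd_nd.
Qed.

(** The residues of 0 and the powers of xi are n + 1 distinct elements. There are no more, since
    [hbar] divides X^n - 1 and a primitive polynomial divides no X^k - 1 with 0 < k < |K| - 1. *)
Lemma card_residue : (#|K| = #|F| ^ m)%N /\ #|K| = n.+1.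
Proof.
have cardK : #|K| = (#|F| ^ m)%N by rewrite card_qfpoly residue_size.
split=> //; apply/eqP; rewrite eqn_leq; apply/andP; split; last first.
  by have := leq_card _ (prim_root_option_inj rho_xi_order);
    rewrite card_option card_ord.
have /primitive_polyP[_ _ prim] := hbar_primitive.
rewrite leqNgt; apply/negP => lt_n.
have lt_0n : (0 < n < #|{poly %/ hbar}|.-1)%N.
  by rewrite (prim_order_gt0 xi_order) /= ltn_predRL.
have [g gE] := h_dvd; case/negP: (prim n lt_0n); apply/dvdpP.
by exists (map_poly red g); rewrite -rmorphM -gE rmorphB rmorph1 /= map_polyXn.
Qed.

Lemma card_F : #|F| = q.
Proof.
have [-> /eqP] := card_residue.
by rewrite card_expn eqn_exp2r // => /eqP.
Qed.

Lemma rho_alg_fix (a : L) : rho a%:A ^+ q = rho a%:A.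
Proof.
have reda : red (a ^+ q - a) = 0.
  by rewrite rmorphB rmorphXn /= -card_F expf_card subrr.
have [_ /(_ (a ^+ q - a))[/(_ reda)[y ay] _]] := red_mod.
apply/eqP; rewrite -subr_eq0 -in_algE -!rmorphXn -!rmorphB ay.
by rewrite rmorphM rmorph_nat rmorphM rho_p mul0r.
Qed.

(** * The q-th power map and the Frobenius automorphism *)

Lemma q_pchar : [pchar K].-nat q.
Proof.
rewrite q_def pnatX pnatE // inE p_prime /=.
by rewrite -(rmorph_nat rho) rho_p eqxx.
Qed.

(** Raising to the power q is additive in characteristic p and fixes the residues of the
    coefficients. *)
Lemma rho_horner_Frobenius (y : R) (u : {poly L}) :
  rho (horner_alg (y ^+ q) u) = rho (horner_alg y u) ^+ q.
Proof.
have hornerE z v a : horner_alg z (v * 'X + a%:P) = horner_alg z v * z + a%:A :> R.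
  by rewrite rmorphD rmorphM /= horner_algX horner_algC.
elim/poly_ind: u => [|u a IHu].
  by rewrite !rmorph0 expr0n gtn_eqF // q_def expn_gt0 prime_gt0.
rewrite !hornerE !rmorphD !rmorphM.
by rewrite exprDn_pchar ?q_pchar // exprMn rho_alg_fix -IHu rmorphXn.
Qed.

(* Since X^n - 1 is separable modulo p, h (xi^q) is annihilated by the unit
   g (xi^q), where g h = X^n - 1. *)
Lemma root_xi_q : horner_alg (xi ^+ q) h = 0.
Proof.
have [g gE] := h_dvd; set y := xi ^+ q.
have yn : y ^+ n = 1 by rewrite exprAC (prim_expr_order xi_order) expr1n.
have gh0 : horner_alg y g * horner_alg y h = 0.
  by rewrite -rmorphM -gE rmorphB rmorph1 rmorphXn /= horner_algX yn subrr.
have rho_h : rho (horner_alg y h) = 0.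
  rewrite rho_horner_Frobenius; have -> : horner_alg xi h = 0 by apply/eqP.
  by rewrite rmorph0 expr0n gtn_eqF // q_def expn_gt0 prime_gt0.
suff /rho_inverse[d gd] : rho (horner_alg y g) != 0.
  by rewrite -[LHS]mul1r -gd mulrAC gh0 mul0r.
apply/eqP => rho_g; pose sigma : {rmorphism L -> K} := rho \o in_alg R.
have sigmaE u : (map_poly sigma u).[rho y] = rho (horner_alg y u).
  by rewrite map_poly_comp horner_map.
have gE' : 'X^n - 1 = map_poly sigma g * map_poly sigma h.
  by rewrite -rmorphM -gE rmorphB rmorph1 /= map_polyXn.
(* If g vanished as well, the residue of y would be a double root of X^n - 1; but n = -1 in K, so
   the derivative vanishes only at 0. *)
have := congr1 (fun u : {poly K} => (deriv u).[rho y]) gE';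
  rewrite derivM hornerD.
rewrite !hornerM !sigmaE rho_h rho_g mul0r mulr0 addr0.
rewrite derivB derivC subr0 derivXn hornerMn hornerXn.
have n1 : n%:R = -1 :> K.
  apply/eqP; rewrite -subr_eq0 opprK natr1 card_expn q_def -expnM.
  have rm_gt0 : (0 < r * m)%N by rewrite muln_gt0 r_gt0.
  rewrite -(prednK rm_gt0) expnS natrM -(rmorph_nat rho p) rho_p mul0r.
  by rewrite eqxx.
rewrite -mulr_natr n1 mulrN1 => /eqP;
  rewrite oppr_eq0 expf_eq0 => /andP[_ /eqP y0].
have := congr1 rho yn;
  rewrite rmorphXn y0 rmorph1 expr0n gtn_eqF ?(prim_order_gt0 xi_order) //.
by move/esym/eqP; rewrite oner_eq0.
Qed.

(** The root xi may differ from the class ['qX] of the variable. [psi1] sends ['qX] to xi and [psiq]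
    sends it to xi^q, so the Frobenius is [psiq] after the inverse of [psi1]. *)
Let psi1 : {rmorphism R -> R} :=
  qpoly_lift h_monic h_size_gt1 (eqP xi_root : horner_alg xi h = 0).
Let psiq : {rmorphism R -> R} :=
  qpoly_lift h_monic h_size_gt1 root_xi_q.

(** By counting, 0 and the powers of xi represent every residue; digits are then split off one power
    of p at a time until p^s = 0. *)
Lemma teichmuller_digits c :
  exists u : {ffun 'I_s -> option 'I_n},
    c = \sum_(i < s) p%:R ^+ i * teichmuller xi (u i).
Proof.
have lift_teich z : exists o : option 'I_n, rho (teichmuller xi o) = z.
  have := inj_card_onto (prim_root_option_inj rho_xi_order).
  rewrite card_option card_ord (proj2 card_residue) => /(_ (leqnn _) z)/codomP[o ->].
  by exists o; case: o => [i|]; rewrite ?rmorphXn ?rmorph0.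
have [u [e ->]] : exists (u : nat -> option 'I_n) e,
    c = \sum_(i < s) p%:R ^+ i * teichmuller xi (u i) + p%:R ^+ s * e.
  elim: (s) => [|k [u [e ->]]].
    by exists (fun=> None), c; rewrite big_ord0 add0r mul1r.
  have [o oE] := lift_teich (rho e).
  have [d dE] : exists d, e - teichmuller xi o = p%:R * d.
    by apply: rho_eq0; rewrite rmorphB oE subrr.
  exists (fun i => if i == k then o else u i), d.
  rewrite big_ord_recr /= eqxx exprSr -mulrA -dE mulrBr addrA addrAC addrK.
  by congr (_ + _); apply: eq_bigr => i _; rewrite ltn_eqF.
exists [ffun i : 'I_s => u i]; rewrite p_nilpotent mul0r addr0.
by apply: eq_bigr => i _; rewrite ffunE.
Qed.

Lemma lift_teichmuller (f : {rmorphism R -> R}) (u : 'I_s -> option 'I_n) :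
  f (\sum_(i < s) p%:R ^+ i * teichmuller 'qX (u i))
    = \sum_(i < s) p%:R ^+ i * teichmuller (f 'qX) (u i).
Proof.
rewrite rmorph_sum; apply: eq_bigr => i _; rewrite rmorphM rmorphXn rmorph_nat.
by congr (_ * _); case: (u i) => [k|]; rewrite ?rmorphXn ?rmorph0.
Qed.

Lemma psi1_X : psi1 'qX = xi.
Proof. by rewrite [LHS]qpoly_liftE; apply: horner_algX. Qed.

Lemma psiq_X : psiq 'qX = xi ^+ q.
Proof. by rewrite [LHS]qpoly_liftE; apply: horner_algX. Qed.

(** Every digit expansion in xi is the image of the one in ['qX], so [psi1] is onto, and R is
    finite. *)
Lemma psi1_inj : injective psi1.
Proof.
suff /image_injP psi_inj : #|image psi1 predT| == #|{: R}|.
  by move=> c d; apply: psi_inj.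
apply/eqP/eq_card => c; rewrite [RHS]inE.
have [u ->] := teichmuller_digits c.
by rewrite -psi1_X -lift_teichmuller image_f.
Qed.

(** A ring morphism sending xi to xi^q raises each digit of an expansion to the power q, so it
    computes [frobenius]. *)
Lemma frobenius_lrmorphism :
  exists2 phi : {lrmorphism R -> R},
    frobenius p s q n xi =1 phi & phi xi = xi ^+ q.
Proof.
pose f c := psiq (invF psi1_inj c).
have f_psi c : f (psi1 c) = psiq c by rewrite /f invF_f.
have psi1_surj c : exists d, c = psi1 d by exists (invF psi1_inj c);
  rewrite f_invF.
have f_zmod : zmod_morphism f.
  move=> c d; have [[c' ->] [d' ->]] := (psi1_surj c, psi1_surj d).
  by rewrite -rmorphB !f_psi rmorphB.
have f_monoid : monoid_morphism f.
  split=> [|c d]; first by rewrite -[X in f X](rmorph1 psi1) f_psi rmorph1.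
  have [[c' ->] [d' ->]] := (psi1_surj c, psi1_surj d).
  by rewrite -rmorphM !f_psi rmorphM.
have f_scale : scalable f.
  move=> a c; have [c' ->] := psi1_surj c.
  have psiZ (y : R) (h0 : horner_alg y h = 0) (d : R) :
      qpoly_lift h_monic h_size_gt1 h0 (a *: d)
        = a *: qpoly_lift h_monic h_size_gt1 h0 d.
    have valZ : val (a *: d) = a%:P * val d by rewrite mul_polyC.
    by rewrite /qpoly_lift valZ rmorphM /= horner_algC mulr_algl.
  transitivity (f (psi1 (a *: c'))); first by congr f; apply/esym/psiZ.
  by rewrite !f_psi; apply: psiZ.
pose phi : {lrmorphism R -> R} := HB.pack f
  (GRing.isZmodMorphism.Build R R f f_zmod)
  (GRing.isMonoidMorphism.Build R R f f_monoid)
  (GRing.isScalable.Build L R R *:%R f f_scale).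
exists phi => [c|]; last by rewrite -[in LHS]psi1_X [LHS]f_psi psiq_X.
rewrite /frobenius; case: pickP => [u /eqP cE|no_u]; last first.
  by have [u cE] := teichmuller_digits c; have := no_u u; rewrite -cE eqxx.
rewrite [in RHS]cE -[in RHS]psi1_X -lift_teichmuller [RHS]f_psi lift_teichmuller psiq_X.
apply: eq_bigr => i _; congr (_ * _); case: (u i) => [k|] /=.
  by rewrite exprAC.
by rewrite expr0n gtn_eqF // q_def expn_gt0 prime_gt0.
Qed.

Variable b : 'I_n -> 'rV[L]_m.
Hypothesis b_coord :
  forall i : 'I_n, xi ^+ i = \sum_(l < m) b i 0 l *: xi ^+ l.

(** Each digit is 0 or some xi^i, whose coordinates are [b i]; these are combined with weights p^i
    over the digit positions. *)
Lemma xi_powers_span c : exists a : 'rV[L]_m, c = \sum_(l < m) a 0 l *: xi ^+ l.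
Proof.
have [u ->] := teichmuller_digits c.
exists (\sum_(i < s) p%:R ^+ i *: (if u i is Some k then b k else 0)).
under [RHS]eq_bigr do rewrite summxE scaler_suml.
rewrite exchange_big; apply: eq_bigr => i _.
under [RHS]eq_bigr do rewrite mxE -scalerA.
rewrite -scaler_sumr -mulr_algl; congr (_ * _).
  by rewrite -in_algE rmorphXn rmorph_nat.
case: (u i) => [k|] /=; first exact: b_coord.
by rewrite big1 // => l _; rewrite mxE scale0r.
Qed.

Lemma RM_generated_by_traces nu (J : {set 'I_n.+1}) :
  coset_representatives q m nu J -> forall c,
  RM q b nu c <->
  generated_by
    (fun v => RM q b 0 v \/
       exists (j : 'I_n.+1) (lambda : R),
         j \in J /\ v = trace_word p s q m n xi j lambda) c.
Proof.
have [phi frobE phi_xi] := frobenius_lrmorphism.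
have q_gt1 : (1 < q)%N.
  by rewrite q_def -(expn0 p) ltn_exp2l ?prime_gt1.
(* R is a finite type here and serves as its own code, through the identity. *)
move=> J_repr c; apply: (@RM_generated p s q m n L R K rho xi phi b R id) => //.
- exact: card_expn.
- exact: alg_qpoly_inj.
- exact: rho_inverse.
- exact: rho_alg_unit.
- exact: rho_alg_fix.
- exact: rho_xi_order.
- exact: prim_expr_order xi_order.
- exact: xi_powers_span.
Qed.

End Residue.

Theorem theorem6p3 (p s r q m n nu : nat)
  (p_prime : prime p) (s_gt0 : (0 < s)%N) (r_gt0 : (0 < r)%N) (m_gt0 : (0 < m)%N)
  (le_s_rm : (s <= r * m)%N)
  (q_def : q = (p ^ r)%N) (n_def : n = (q ^ m).-1)
  (nu_ge1 : (1 <= nu)%N) (nu_le : (nu <= m * q.-1)%N)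
  (L : finComUnitRingType) (L_galois : galois_ring p s r L)
  (F : finFieldType) (red : {rmorphism L -> F}) (red_mod : reduction_mod p red)
  (h : {poly L}) (h_primitive : basic_primitive red h) (h_size : size h = m.+1)
  (h_dvd : exists g : {poly L}, 'X^n - 1 = g * h)
  (xi : {poly %/ h})
  (xi_root : root (map_poly (in_alg {poly %/ h}) h) xi)
  (xi_order : n.-primitive_root xi)
  (b : 'I_n -> 'rV[L]_m)
  (b_coord : forall i : 'I_n, xi ^+ i = \sum_(l < m) b i 0 l *: xi ^+ l)
  (J : {set 'I_n.+1}) (J_repr : coset_representatives q m nu J) :
  forall c : 'rV[L]_n.+1,
    RM q b nu c <->
    generated_by
      (fun v : 'rV[L]_n.+1 =>
         RM q b 0 v \/
         exists (j : 'I_n.+1) (lambda : {poly %/ h}),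
           j \in J /\ v = trace_word p s q m n xi j lambda)
      c.
Proof.
exact: (RM_generated_by_traces p_prime r_gt0 m_gt0 q_def n_def L_galois red_mod
  h_primitive h_size h_dvd xi_root xi_order b_coord J_repr).
Qed.
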